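(* Let $m$ be a non-negative integer, let $S_m(x):=\int_{0}^{x}\sin^{2m+1}(\pi t)\,dt$ and $\mathcal{T}_m(x):=S_m(x)/S_m(1)$ for $0\le x\le 1$. Consider the linear ordinary differential equation of order $2m+2$ $$(D^2+(2m+1)^2\pi^2 I)\cdots(D^2+3^2\pi^2 I)(D^2+\pi^2 I)\,y=c_m,\qquad c_m=\frac{\left(1\cdot 3\cdots(2m+1)\,\pi^{m+1}\right)^2}{2}.$$ Then on $[0,1]$: (a) $\mathcal{T}_m$ is the (unique) solution of this equation subject to the initial conditions $y^{(k)}(0)=0$ for $k=0,\dots,2m+1$; (b) $\mathcal{T}_m$ is the (unique) solution of this equation subject to the two-point boundary conditions $y(0)=0$, $y(1)=1$, and $y^{(k)}(0)=0$, $y^{(k)}(1)=0$ for $k=1,\dots,2m+1$.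
   Context: $D^2=d^2/dx^2$, $I$ is the identity operator, and the left-hand side is the composition of the operators $D^2+(2j+1)^2\pi^2 I$ for $j=0,\dots,m$ applied to $y$. *)

(* Defs.v *)
From Stdlib Require Import Reals Lra ClassicalEpsilon.
From Coquelicot Require Import Coquelicot.
Open Scope R_scope.

Definition I01 (x : R) : Prop := 0 <= x <= 1.

(* Derivative, at a point of [0,1], of a function on [0,1]: the limit of
   difference quotients is taken within [0,1], hence it is one-sided at 0 and 1.
   For x in [0,1] the result depends only on the values of f on [0,1]; it is
   unspecified where the limit does not exist, and for x outside [0,1]. *)
Definition D01 (f : R -> R) (x : R) : R :=
  epsilon (inhabits 0) (fun l => D_in f (fun _ => l) I01 x).

Definition ex_D01 (f : R -> R) (x : R) : Prop :=
  exists l, D_in f (fun _ => l) I01 x.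

Definition D01_n (k : nat) (f : R -> R) : R -> R := Nat.iter k D01 f.

Definition ex_D01_n (n : nat) (f : R -> R) : Prop :=
  forall k, (k < n)%nat -> forall x, I01 x -> ex_D01 (D01_n k f) x.

Lemma D01_correct f x l : I01 x -> D_in f (fun _ => l) I01 x -> D01 f x = l.
Proof.
  intros Hx Hl.
  assert (He : D_in f (fun _ => D01 f x) I01 x).
  { unfold D01. apply epsilon_spec. now exists l. }
  refine (single_limit _ _ _ _ _ _ He Hl).
  intros a Ha.
  assert (Hh : 0 < Rmin (a / 2) (1 / 2)) by (apply Rmin_pos; lra).
  pose proof (Rmin_l (a / 2) (1 / 2)). pose proof (Rmin_r (a / 2) (1 / 2)).
  set (h := Rmin (a / 2) (1 / 2)) in *.
  unfold I01 in Hx.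
  destruct (Rle_dec x (1 / 2)); [exists (x + h) | exists (x - h)];
    (split; [unfold D_x, I01; lra | simpl; unfold Rdist; apply Rabs_def1; lra]).
Qed.

Definition ode_factor (j : nat) (y : R -> R) : R -> R :=
  fun x => D01_n 2 y x + INR (2 * j + 1) ^ 2 * PI ^ 2 * y x.

(* The factor j = 0 is applied first. *)
Fixpoint ode_op (m : nat) (y : R -> R) : R -> R :=
  match m with
  | O => ode_factor 0 y
  | S m' => ode_factor m (ode_op m' y)
  end.

(* prod_f_R0 runs over j = 0, ..., m, both ends included. *)
Definition ode_rhs (m : nat) : R :=
  (prod_f_R0 (fun j => INR (2 * j + 1)) m * PI ^ (m + 1)) ^ 2 / 2.

Definition ode_solution (m : nat) (y : R -> R) : Prop :=
  ex_D01_n (2 * m + 2) y /\ forall x, I01 x -> ode_op m y x = ode_rhs m.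

Definition ivp_solution (m : nat) (y : R -> R) : Prop :=
  ode_solution m y /\
  forall k, (k <= 2 * m + 1)%nat -> D01_n k y 0 = 0.

Definition bvp_solution (m : nat) (y : R -> R) : Prop :=
  ode_solution m y /\ y 0 = 0 /\ y 1 = 1 /\
  forall k, (1 <= k <= 2 * m + 1)%nat -> D01_n k y 0 = 0 /\ D01_n k y 1 = 0.

Definition S_ (m : nat) (x : R) : R :=
  RInt (fun t => sin (PI * t) ^ (2 * m + 1)) 0 x.

Definition T_ (m : nat) (x : R) : R := S_ m x / S_ m 1.

(* Main.v *)
Require Import Defs.
From Stdlib Require Import Reals Lra Lia Wf_nat.
From Coquelicot Require Import Coquelicot.
Open Scope R_scope.

(** Write [a_j = (2j+1)^2 pi^2].  Everything rests on the identity
    [T_m'' = a_m (T_(m-1) - T_m)], that is [(D^2 + a_m) T_m = a_m T_(m-1)],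
    which also holds for [m = 0] when [T_(-1)] is read as the constant [1/2].
    It is the reduction formula for the integral of [sin^(2m+1)], normalised
    by its value at [x = 1] ([S_reduction],
    [T_second_derivative]); for [m = 0] it is read off the closed form of the
    integral of [sin].

    Existence.  The factors of the operator commute, so applying the factor of
    index [m] first turns [T_m] into [a_m T_(m-1)], the next one gives
    [a_m a_(m-1) T_(m-2)], and so on down to [a_m ... a_0 / 2 = c_m].  The same
    identity expresses the derivative of order [k+2] of [T_m] by the derivatives
    of order [k] of [T_(m-1)] and [T_m]; since [T_m] goes from [0] to [1] for
    every [m >= 0] and [T_m'] vanishes at both ends, all derivatives of orders
    [1, ..., 2m+1] vanish at both ends.

    Uniqueness.  The boundary conditions at [0] alone are the initial
    conditions, so only the initial value problem matters.  The difference [w]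
    of two solutions has zero initial data and is annihilated by the operator.
    Peeling off the outermost factor, [u = (D^2 + a_(m-1)) ... (D^2 + a_0) w]
    satisfies [u'' + a_m u = 0] with [u(0) = u'(0) = 0]; its energy
    [u'^2 + a_m u^2] is constant, hence zero, so [u = 0]; then induct.

    The iterated one-sided derivatives are handled through jets: sequences [g]
    of functions in which [g (k+1)] is the derivative of [g k] within [0,1].
    On jets the operator is plain algebra on the index [k]. *)

(** * Jets of functions on the unit interval *)

Definition jet (N : nat) (g : nat -> R -> R) : Prop :=
  forall k, (k < N)%nat -> forall x, I01 x -> D_in (g k) (g (S k)) I01 x.

Lemma D_in_I01_ext f g d x :
  (forall t, I01 t -> f t = g t) -> I01 x -> D_in f d I01 x -> D_in g d I01 x.
Proof.
  intros E Hx H eps He.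
  destruct (H eps He) as [al [Hal H']].
  exists al; split; [exact Hal|].
  intros t [[Ht Hne] Hd].
  rewrite <- (E t Ht), <- (E x Hx).
  now apply H'.
Qed.

Lemma is_derive_D_in f d x : is_derive f x (d x) -> D_in f d I01 x.
Proof.
  intros H.
  apply (D_in_imp f d no_cond I01 x); [intros; exact Logic.I|].
  apply derivable_pt_lim_D_in, is_derive_Reals, H.
Qed.

Lemma D01_n_jet N g y :
  jet N g -> (forall x, I01 x -> y x = g 0%nat x) ->
  forall k, (k <= N)%nat -> forall x, I01 x -> D01_n k y x = g k x.
Proof.
  intros Hg Hy k; induction k as [|k IH]; intros Hk x Hx; [now apply Hy|].
  change (D01 (D01_n k y) x = g (S k) x).
  apply D01_correct; [exact Hx|].
  apply (D_in_I01_ext (g k)); [|exact Hx|].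
  - intros t Ht; symmetry; apply IH; [lia|exact Ht].
  - apply (Hg k); [lia|exact Hx].
Qed.

Lemma jet_ex_D01_n N g y :
  jet N g -> (forall x, I01 x -> y x = g 0%nat x) -> ex_D01_n N y.
Proof.
  intros Hg Hy k Hk x Hx.
  exists (g (S k) x).
  apply (D_in_I01_ext (g k)); [|exact Hx|].
  - intros t Ht; symmetry; apply (D01_n_jet N g y); auto; lia.
  - exact (Hg k Hk x Hx).
Qed.

Lemma ex_D01_n_jet N y : ex_D01_n N y -> jet N (fun k => D01_n k y).
Proof.
  intros H k Hk x Hx.
  destruct (H k Hk x Hx) as [l Hl].
  assert (E : D01 (D01_n k y) x = l) by now apply D01_correct.
  change (D_in (D01_n k y) (fun _ => D01 (D01_n k y) x) I01 x).
  now rewrite E.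
Qed.

Lemma jet_minus N g h :
  jet N g -> jet N h -> jet N (fun k x => g k x - h k x).
Proof.
  intros Hg Hh k Hk x Hx.
  apply (Dminus I01 (g (S k)) (h (S k)) (g k) (h k)); auto.
Qed.

(** * The operator on jets *)

Definition freq2 (j : nat) : R := INR (2 * j + 1) ^ 2 * PI ^ 2.

Definition jet_factor (j : nat) (g : nat -> R -> R) : nat -> R -> R :=
  fun k x => g (S (S k)) x + freq2 j * g k x.

(** The first [n] factors, so that [ode_op m] corresponds to [n = m + 1]; the
    empty product [n = 0] is the natural base of the inductions. *)
Fixpoint jet_op (n : nat) (g : nat -> R -> R) : nat -> R -> R :=
  match n with
  | O => g
  | S j => jet_factor j (jet_op j g)
  end.

Lemma jet_factor_jet j N g : jet (S (S N)) g -> jet N (jet_factor j g).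
Proof.
  intros Hg k Hk x Hx.
  apply (Dadd I01 (g (S (S (S k)))) (fun t => freq2 j * g (S k) t)
           (g (S (S k))) (fun t => freq2 j * g k t)).
  - apply Hg; [lia|exact Hx].
  - apply Dmult_const, Hg; [lia|exact Hx].
Qed.

Lemma jet_op_jet n : forall N g, jet (2 * n + N) g -> jet N (jet_op n g).
Proof.
  induction n as [|n IH]; intros N g Hg; [exact Hg|].
  apply jet_factor_jet, IH.
  now replace (2 * n + S (S N))%nat with (2 * S n + N)%nat by lia.
Qed.

Lemma ode_op_jet n y g :
  jet (2 * n + 2) g -> (forall x, I01 x -> y x = g 0%nat x) ->
  forall x, I01 x -> ode_op n y x = jet_op (S n) g 0%nat x.
Proof.
  induction n as [|n IH]; intros Hg Hy x Hx.
  - change (D01_n 2 y x + freq2 0 * y x = g 2%nat x + freq2 0 * g 0%nat x).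
    rewrite (D01_n_jet 2 g y Hg Hy 2 (le_n 2) x Hx), (Hy x Hx).
    reflexivity.
  - assert (Hn : forall t, I01 t -> ode_op n y t = jet_op (S n) g 0%nat t).
    { apply IH; [|exact Hy]. intros k Hk. apply Hg. lia. }
    assert (Hj : jet 2 (jet_op (S n) g)) by now apply jet_op_jet.
    change (D01_n 2 (ode_op n y) x + freq2 (S n) * ode_op n y x =
            jet_op (S n) g 2%nat x + freq2 (S n) * jet_op (S n) g 0%nat x).
    rewrite (D01_n_jet 2 _ _ Hj Hn 2 (le_n 2) x Hx), (Hn x Hx).
    reflexivity.
Qed.

Lemma jet_op_minus n g h x : forall k,
  jet_op n (fun k x => g k x - h k x) k x = jet_op n g k x - jet_op n h k x.
Proof.
  induction n as [|n IH]; intros k; [reflexivity|].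
  simpl; unfold jet_factor; rewrite !IH; ring.
Qed.

Lemma jet_op_scal n c g h x :
  (forall k, h k x = c * g k x) -> forall k, jet_op n h k x = c * jet_op n g k x.
Proof.
  intros E; induction n as [|n IH]; intros k; [apply E|].
  simpl; unfold jet_factor; rewrite !IH; ring.
Qed.

Lemma jet_op_factor_comm n j g x : forall k,
  jet_op n (jet_factor j g) k x = jet_factor j (jet_op n g) k x.
Proof.
  induction n as [|n IH]; intros k; [reflexivity|].
  simpl. unfold jet_factor at 1. rewrite !IH.
  unfold jet_factor; ring.
Qed.

Lemma jet_op_zero n g x K :
  (forall k, (k < 2 * n + K)%nat -> g k x = 0) ->
  forall k, (k < K)%nat -> jet_op n g k x = 0.
Proof.
  revert K; induction n as [|n IH]; intros K E k Hk; [now apply E|].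
  simpl; unfold jet_factor.
  rewrite !(IH (S (S K))); [ring| | | |]; try lia;
    intros i Hi; apply E; lia.
Qed.

(** * Uniqueness for the initial value problem *)

(** Extending [f] by constants outside [0,1] gives a function whose two-sided
    derivative vanishes on [0,1], endpoints included. *)
Lemma D_in_I01_zero_const f :
  (forall x, I01 x -> D_in f (fun _ => 0) I01 x) ->
  forall x, I01 x -> f x = f 0.
Proof.
  intros H.
  set (c := fun t => Rmax 0 (Rmin 1 t)).
  assert (Hc : forall t, I01 (c t)).
  { intros t; unfold c, I01, Rmax, Rmin; repeat destruct Rle_dec; lra. }
  assert (Hid : forall t, I01 t -> c t = t).
  { intros t; unfold c, I01, Rmax, Rmin; repeat destruct Rle_dec; lra. }
  assert (Hlip : forall s t, Rabs (c s - c t) <= Rabs (s - t)).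
  { intros s t; unfold c, Rmax, Rmin, Rabs;
      repeat destruct Rle_dec; repeat destruct Rcase_abs; lra. }
  assert (HF : forall x, I01 x -> is_derive (fun t => f (c t)) x 0).
  { intros x Hx. apply is_derive_Reals. intros eps He.
    destruct (H x Hx eps He) as [al [Hal H']].
    exists (mkposreal al Hal). simpl. intros h Hh0 Hh.
    rewrite Rminus_0_r, (Hid x Hx).
    assert (Hl := Hlip (x + h) x).
    rewrite (Hid x Hx), Rplus_minus_l in Hl.
    assert (Hp : 0 < Rabs h) by now apply Rabs_pos_lt.
    destruct (Req_dec (c (x + h)) x) as [E|NE].
    { rewrite E. replace ((f x - f x) / h) with 0 by (field; exact Hh0).
      now rewrite Rabs_R0. }
    specialize (H' (c (x + h))). simpl in H'. unfold Rdist in H'.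
    rewrite Rminus_0_r in H'.
    assert (Hq : Rabs ((f (c (x + h)) - f x) / (c (x + h) - x)) < eps).
    { apply H'. split; [|lra]. split; [apply Hc|]. auto. }
    assert (Hne : c (x + h) - x <> 0) by lra.
    replace ((f (c (x + h)) - f x) / h) with
      ((f (c (x + h)) - f x) / (c (x + h) - x) * ((c (x + h) - x) / h))
      by (field; split; assumption).
    rewrite Rabs_mult, (Rabs_div (c (x + h) - x)) by exact Hh0.
    apply Rle_lt_trans with
      (Rabs ((f (c (x + h)) - f x) / (c (x + h) - x)) * 1); [|lra].
    apply Rmult_le_compat_l; [apply Rabs_pos|].
    apply Rle_div_l; lra. }
  intros x Hx. destruct Hx as [[Hx0|Hx0] Hx1]; [|now subst].
  rewrite <- (Hid x), <- (Hid 0) by (unfold I01; lra).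
  symmetry. apply (eq_is_derive (fun t => f (c t)) 0 x); [|exact Hx0].
  intros t Ht. apply HF. unfold I01; lra.
Qed.

Lemma freq2_pos j : 0 < freq2 j.
Proof.
  apply Rmult_lt_0_compat; apply pow_lt.
  - apply lt_0_INR; lia.
  - apply PI_RGT_0.
Qed.

(** Conservation of the energy [u'^2 + a u^2]. *)
Lemma oscillator_zero a u :
  0 < a -> jet 2 u ->
  (forall x, I01 x -> u 2%nat x + a * u 0%nat x = 0) ->
  u 0%nat 0 = 0 -> u 1%nat 0 = 0 ->
  forall x, I01 x -> u 0%nat x = 0.
Proof.
  intros Ha Hu Hode H0 H1 x Hx.
  set (E := fun t => u 1%nat t * u 1%nat t + a * (u 0%nat t * u 0%nat t)).
  assert (HE : E x = E 0).
  { apply D_in_I01_zero_const; [|exact Hx].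
    intros t Ht.
    assert (D0 := Hu 0%nat ltac:(lia) t Ht).
    assert (D1 := Hu 1%nat ltac:(lia) t Ht).
    assert (DE := Dadd _ _ _ _ _ _ (Dmult _ _ _ _ _ _ D1 D1)
                   (Dmult_const _ _ _ _ a (Dmult _ _ _ _ _ _ D0 D0))).
    unfold D_in in DE |- *.
    match type of DE with limit1_in _ _ ?l _ =>
      replace 0 with l; [exact DE|] end.
    specialize (Hode t Ht).
    replace (u 2%nat t) with (- (a * u 0%nat t)) by lra. ring. }
  unfold E in HE. rewrite H0, H1 in HE.
  assert (P0 := Rle_0_sqr (u 0%nat x)). assert (P1 := Rle_0_sqr (u 1%nat x)).
  unfold Rsqr in P0, P1.
  assert (Z : a * (u 0%nat x * u 0%nat x) = 0).
  { assert (0 <= a * (u 0%nat x * u 0%nat x))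
      by (apply Rmult_le_pos; [lra|exact P0]). lra. }
  apply Rmult_integral in Z; destruct Z as [Z|Z]; [lra|].
  apply Rmult_integral in Z; tauto.
Qed.

(** Induction on the number of factors: the outermost one is an oscillator
    equation for the image of the jet under all the others. *)
Lemma jet_op_kernel_zero n w :
  jet (2 * n) w ->
  (forall k, (k < 2 * n)%nat -> w k 0 = 0) ->
  (forall x, I01 x -> jet_op n w 0%nat x = 0) ->
  forall x, I01 x -> w 0%nat x = 0.
Proof.
  induction n as [|n IH]; intros Hw H0 Hop; [exact Hop|].
  apply IH.
  - intros k Hk. apply Hw. lia.
  - intros k Hk. apply H0. lia.
  - apply (oscillator_zero (freq2 n) (jet_op n w)).
    + apply freq2_pos.
    + apply jet_op_jet. now replace (2 * n + 2)%nat with (2 * S n)%nat by lia.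
    + exact Hop.
    + apply (jet_op_zero n w 0 2); [|lia]. intros k Hk; apply H0; lia.
    + apply (jet_op_zero n w 0 2); [|lia]. intros k Hk; apply H0; lia.
Qed.

Lemma ivp_solution_unique m y z :
  ivp_solution m y -> ivp_solution m z -> forall x, I01 x -> y x = z x.
Proof.
  intros [[Ey Oy] Iy] [[Ez Oz] Iz] x Hx.
  assert (Jy := ex_D01_n_jet _ _ Ey). assert (Jz := ex_D01_n_jet _ _ Ez).
  apply Rminus_diag_uniq.
  apply (jet_op_kernel_zero (S m) (fun k t => D01_n k y t - D01_n k z t));
    [| | |exact Hx].
  - replace (2 * S m)%nat with (2 * m + 2)%nat by lia. now apply jet_minus.
  - intros k Hk. rewrite Iy, Iz by lia. ring.
  - intros t Ht. rewrite (jet_op_minus (S m) (fun k => D01_n k y)).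
    rewrite <- (ode_op_jet m y _ Jy), <- (ode_op_jet m z _ Jz) by auto.
    rewrite Oy, Oz by exact Ht. ring.
Qed.

(** * The reduction formula *)

Lemma S_is_derive m x : is_derive (S_ m) x (sin (PI * x) ^ (2 * m + 1)).
Proof.
  assert (Hc : forall t, continuous (fun s => sin (PI * s) ^ (2 * m + 1)) t).
  { intros t. apply (ex_derive_continuous (V := R_NormedModule)).
    auto_derive. exact Logic.I. }
  unfold S_.
  apply (is_derive_RInt (fun s => sin (PI * s) ^ (2 * m + 1)) _ 0 x).
  - apply filter_forall. intros t.
    apply (RInt_correct (V := R_CompleteNormedModule)).
    apply (ex_RInt_continuous (V := R_CompleteNormedModule)). intros; apply Hc.
  - apply Hc.
Qed.

Lemma S_0 m : S_ m 0 = 0.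
Proof. apply (RInt_point (V := R_CompleteNormedModule)). Qed.

Lemma is_derive_zero_const (f : R -> R) :
  (forall x, is_derive f x 0) -> forall x, f x = f 0.
Proof.
  intros H x.
  destruct (Rtotal_order 0 x) as [L|[L|L]]; [| now subst |].
  - symmetry; apply (eq_is_derive f 0 x); auto.
  - apply (eq_is_derive f x 0); auto.
Qed.

Lemma sin_pow_cos_is_derive k x :
  is_derive (fun t : R => sin (PI * t) ^ S k * cos (PI * t)) x
    (PI * (INR (S k) * sin (PI * x) ^ k
           - (INR (S k) + 1) * sin (PI * x) ^ S (S k))).
Proof.
  assert (Hc : cos (PI * x) * cos (PI * x) = 1 - sin (PI * x) * sin (PI * x)).
  { generalize (sin2_cos2 (PI * x)). unfold Rsqr. lra. }
  apply (is_derive_ext (fun t => cos (PI * t) * sin (PI * t) ^ S k));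
    [intros; apply Rmult_comm|].
  auto_derive; [exact Logic.I|].
  change (Init.Nat.pred (S k)) with k.
  change (match k with O => 1 | S _ => INR k + 1 end) with (INR (S k)).
  rewrite <- !tech_pow_Rmult.
  transitivity (PI * sin (PI * x) ^ k *
    (INR (S k) * (cos (PI * x) * cos (PI * x)) - sin (PI * x) * sin (PI * x)));
    [|rewrite Hc]; ring.
Qed.

(** [sin_pow_cos_is_derive] for the exponent [2m+2], integrated from [0] to
    [x]. *)
Lemma S_reduction m x :
  let n := INR (2 * S m + 1) in
  sin (PI * x) ^ (2 * S m) * cos (PI * x) =
  PI * ((n - 1) * S_ m x - n * S_ (S m) x).
Proof.
  intros n.
  set (F := fun t => sin (PI * t) ^ (2 * S m) * cos (PI * t)
    - PI * ((n - 1) * S_ m t - n * S_ (S m) t)).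
  assert (HF : F x = F 0).
  { apply is_derive_zero_const. intros t.
    assert (D0 := sin_pow_cos_is_derive (2 * m + 1) t).
    assert (D1 := S_is_derive m t). assert (D2 := S_is_derive (S m) t).
    replace (S (S (2 * m + 1))) with (2 * S m + 1)%nat in D0 by lia.
    replace (S (2 * m + 1)) with (2 * S m)%nat in D0 by lia.
    unfold F.
    set (f := fun t : R => sin (PI * t) ^ (2 * S m) * cos (PI * t)) in *.
    apply (is_derive_ext
      (fun t => f t - PI * ((n - 1) * S_ m t - n * S_ (S m) t)));
      [reflexivity|].
    clearbody f.
    auto_derive.
    - repeat apply conj; try exact Logic.I; eexists; eassumption.
    - rewrite (is_derive_unique (fun u : R => f u) _ _ D0),
        (is_derive_unique (fun u : R => S_ m u) _ _ D1),
        (is_derive_unique (fun u : R => S_ (S m) u) _ _ D2).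
      unfold n. rewrite (plus_INR (2 * S m) 1). simpl (INR 1). ring. }
  assert (Z : F 0 = 0).
  { unfold F. rewrite Rmult_0_r, sin_0, !S_0, pow_i by lia. ring. }
  rewrite Z in HF. unfold F in HF. lra.
Qed.

Lemma S_0_closed x : PI * S_ 0 x = 1 - cos (PI * x).
Proof.
  set (F := fun t => PI * S_ 0 t + cos (PI * t)).
  assert (HF : F x = F 0).
  { apply is_derive_zero_const. intros t.
    assert (D := S_is_derive 0 t).
    unfold F. auto_derive.
    - repeat apply conj; try exact Logic.I; eexists; eassumption.
    - rewrite (is_derive_unique (fun u : R => S_ 0 u) _ _ D). simpl. ring. }
  unfold F in HF. rewrite S_0, Rmult_0_r, cos_0 in HF. lra.
Qed.

Lemma S_1_reduction m :
  INR (2 * S m + 1) * S_ (S m) 1 = (INR (2 * S m + 1) - 1) * S_ m 1.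
Proof.
  assert (H := S_reduction m 1). cbv zeta in H.
  rewrite Rmult_1_r, sin_PI, pow_i, Rmult_0_l in H by lia.
  symmetry in H. apply Rmult_integral in H.
  destruct H as [H|H]; [|lra].
  generalize PI_RGT_0; lra.
Qed.

Lemma S_1_neq_0 m : S_ m 1 <> 0.
Proof.
  induction m as [|m IH]; intros H.
  - assert (E := S_0_closed 1). rewrite H, Rmult_1_r, cos_PI in E. lra.
  - assert (E := S_1_reduction m). rewrite H, Rmult_0_r in E.
    symmetry in E. apply Rmult_integral in E. destruct E as [E|E]; [|auto].
    rewrite plus_INR in E. simpl (INR 1) in E.
    assert (0 < INR (2 * S m)) by (apply lt_0_INR; lia). lra.
Qed.

(** * The jet of the normalised integral *)

(** [Tseq p] is [T_(p-1)], with the constant [1/2] playing the role of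
    [T_(-1)]; [Tseq' p] is its derivative. *)
Definition Tseq (p : nat) : R -> R :=
  match p with O => fun _ => / 2 | S m => T_ m end.

Definition Tseq' (p : nat) : R -> R :=
  match p with
  | O => fun _ => 0
  | S m => fun x => sin (PI * x) ^ (2 * m + 1) / S_ m 1
  end.

Lemma T_is_derive m x : is_derive (T_ m) x (Tseq' (S m) x).
Proof.
  assert (D := S_is_derive m x).
  unfold T_, Tseq'. auto_derive.
  - eexists; exact D.
  - rewrite (is_derive_unique (fun u : R => S_ m u) _ _ D). unfold Rdiv. ring.
Qed.

(** The key identity [T_m'' = a_m (T_(m-1) - T_m)].  At [x = 1] the reduction
    formula compares the normalising constants [S_m(1)] and [S_(m-1)(1)], which
    makes the coefficients of [T_(m-1)] and [T_m] opposite. *)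
Lemma T_second_derivative m x :
  is_derive (Tseq' (S m)) x (freq2 m * (Tseq m x - T_ m x)).
Proof.
  assert (N0 := S_1_neq_0 m). assert (P0 := PI_RGT_0).
  unfold Tseq'. auto_derive; [exact Logic.I|].
  destruct m as [|m].
  - assert (E1 := S_0_closed 1). rewrite Rmult_1_r, cos_PI in E1.
    assert (Ex := S_0_closed x).
    unfold Tseq, T_, freq2. simpl.
    replace (S_ 0 x) with ((1 - cos (PI * x)) / PI) by (rewrite <- Ex; field; lra).
    replace (S_ 0 1) with (2 / PI) by (apply (Rmult_eq_reg_l PI); [|lra];
      rewrite E1; field; lra).
    field; lra.
  - assert (N1 := S_1_neq_0 m).
    assert (E1 := S_1_reduction m). assert (Ex := S_reduction m x).
    cbv zeta in Ex.
    replace (S m + (S m + 0) + 1)%nat with (2 * S m + 1)%nat by lia.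
    replace (Init.Nat.pred (2 * S m + 1)) with (2 * S m)%nat by lia.
    unfold Tseq, T_, freq2.
    set (n := INR (2 * S m + 1)) in *.
    transitivity (n * PI * (sin (PI * x) ^ (2 * S m) * cos (PI * x)) / S_ (S m) 1);
      [field; exact N0|].
    rewrite Ex.
    transitivity (n * PI ^ 2 *
      ((n - 1) * S_ m 1 * (S_ m x / S_ m 1) - n * S_ (S m) x) / S_ (S m) 1);
      [field; split; assumption|].
    rewrite <- E1. field; split; assumption.
Qed.

(** [Tjet k p] is the derivative of order [k] of [Tseq p]: beyond [k = 1] the
    key identity defines it. *)
Fixpoint Tjet (k p : nat) (x : R) : R :=
  match k with
  | O => Tseq p x
  | S O => Tseq' p x
  | S (S k') =>
      match p with
      | O => 0
      | S m => freq2 m * (Tjet k' m x - Tjet k' p x)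
      end
  end.

Lemma Tjet_is_derive k : forall p x, is_derive (Tjet k p) x (Tjet (S k) p x).
Proof.
  induction k as [k IH] using lt_wf_ind; intros [|m] x.
  - destruct k as [|[|k]];
      [apply (is_derive_const (/ 2) x)|apply (is_derive_const 0 x)..].
  - destruct k as [|[|k]].
    + apply T_is_derive.
    + apply T_second_derivative.
    + apply (is_derive_scal (fun t => Tjet k m t - Tjet k (S m) t)).
      apply (is_derive_minus (Tjet k m) (Tjet k (S m))); apply IH; lia.
Qed.

Lemma Tjet_jet N p : jet N (fun k => Tjet k p).
Proof. intros k _ x _. apply is_derive_D_in, Tjet_is_derive. Qed.

Lemma freq2_prod m : prod_f_R0 freq2 m / 2 = ode_rhs m.
Proof.
  unfold ode_rhs. f_equal.
  induction m as [|m IH].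
  - unfold freq2; simpl. ring.
  - set (odd := fun j => INR (2 * j + 1)) in *.
    change (prod_f_R0 freq2 m * freq2 (S m) =
            (prod_f_R0 odd m * odd (S m) * (PI * PI ^ (m + 1))) ^ 2).
    rewrite IH. change (freq2 (S m)) with (odd (S m) ^ 2 * PI ^ 2). ring.
Qed.

(** The factors commute, so the one of index [m], though outermost, may act
    first, and it sends [T_m] to [a_m T_(m-1)]. *)
Lemma jet_op_T m x :
  jet_op (S m) (fun k => Tjet k (S m)) 0%nat x = prod_f_R0 freq2 m / 2.
Proof.
  assert (Hstep : forall p, jet_op (S p) (fun k => Tjet k (S p)) 0%nat x =
                            freq2 p * jet_op p (fun k => Tjet k p) 0%nat x).
  { intros p. change (jet_op (S p)) with (fun g => jet_factor p (jet_op p g)).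
    cbv beta. rewrite <- jet_op_factor_comm.
    apply jet_op_scal. intros k. unfold jet_factor. simpl. ring. }
  induction m as [|m IH]; rewrite Hstep.
  - simpl. unfold Rdiv. ring.
  - rewrite IH. simpl prod_f_R0. unfold Rdiv. ring.
Qed.

(** * Values at the end points *)

Lemma T_0 m : T_ m 0 = 0.
Proof. unfold T_. rewrite S_0. apply Rmult_0_l. Qed.

Lemma T_1 m : T_ m 1 = 1.
Proof. apply Rdiv_diag, S_1_neq_0. Qed.

Lemma Tjet_0 k : forall m, (k <= 2 * m + 1)%nat -> Tjet k (S m) 0 = 0.
Proof.
  induction k as [k IH] using lt_wf_ind; intros m Hk.
  destruct k as [|[|k]].
  - apply T_0.
  - simpl. rewrite Rmult_0_r, sin_0, pow_i by lia. apply Rmult_0_l.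
  - destruct m as [|m]; [lia|].
    change (freq2 (S m) * (Tjet k (S m) 0 - Tjet k (S (S m)) 0) = 0).
    rewrite !IH by lia. ring.
Qed.

Lemma Tjet_1 k : forall m, (1 <= k <= 2 * m + 1)%nat -> Tjet k (S m) 1 = 0.
Proof.
  induction k as [k IH] using lt_wf_ind; intros m Hk.
  destruct k as [|[|k]].
  - lia.
  - simpl. rewrite Rmult_1_r, sin_PI, pow_i by lia. apply Rmult_0_l.
  - destruct m as [|m]; [lia|].
    change (freq2 (S m) * (Tjet k (S m) 1 - Tjet k (S (S m)) 1) = 0).
    destruct k as [|k].
    + simpl. rewrite !T_1. ring.
    + rewrite !IH by lia. ring.
Qed.

(** * Existence and conclusion *)

Lemma D01_n_T k m x : I01 x -> D01_n k (T_ m) x = Tjet k (S m) x.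
Proof.
  now apply (D01_n_jet k _ _ (Tjet_jet k (S m))).
Qed.

Lemma T_ode_solution m : ode_solution m (T_ m).
Proof.
  split.
  - now apply (jet_ex_D01_n _ _ _ (Tjet_jet (2 * m + 2) (S m))).
  - intros x Hx.
    rewrite (ode_op_jet m _ _ (Tjet_jet _ (S m))) by auto.
    rewrite jet_op_T. apply freq2_prod.
Qed.

Lemma T_ivp_solution m : ivp_solution m (T_ m).
Proof.
  split; [apply T_ode_solution|].
  intros k Hk. rewrite D01_n_T by (unfold I01; lra). now apply Tjet_0.
Qed.

Lemma T_bvp_solution m : bvp_solution m (T_ m).
Proof.
  split; [apply T_ode_solution|].
  split; [apply T_0|]. split; [apply T_1|].
  intros k Hk. rewrite !D01_n_T by (unfold I01; lra).
  split; [apply Tjet_0; lia|now apply Tjet_1].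
Qed.

Lemma bvp_solution_ivp m y : bvp_solution m y -> ivp_solution m y.
Proof.
  intros [Ho [H0 [_ Hd]]]. split; [exact Ho|].
  intros [|k] Hk; [exact H0|]. apply Hd. lia.
Qed.

Theorem mainTheorem12 (m : nat) :
  (ivp_solution m (T_ m) /\
   forall y : R -> R, ivp_solution m y -> forall x : R, 0 <= x <= 1 -> y x = T_ m x) /\
  (bvp_solution m (T_ m) /\
   forall y : R -> R, bvp_solution m y -> forall x : R, 0 <= x <= 1 -> y x = T_ m x).
Proof.
  split; split.
  - apply T_ivp_solution.
  - intros y Hy. apply (ivp_solution_unique m); [exact Hy|apply T_ivp_solution].
  - apply T_bvp_solution.
  - intros y Hy. apply (ivp_solution_unique m);
      [now apply bvp_solution_ivp|apply T_ivp_solution].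
Qed.
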